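(* Let $n$ be a positive integer. If $(\prec)$ is a translation-invariant total order (TITO), then $\widetilde{\mathrm{LowerArcs}}(\prec)$ is a cyclic non-crossing collection. The map $(\prec)\mapsto\widetilde{\mathrm{LowerArcs}}(\prec)$ restricts to a bijection between widely generated elements of $\mathrm{WO}(\mathrm{TTot}_n)$ and cyclic non-crossing collections.
   Context: Fix $n\ge1$. A TITO is a (strict) total order $\prec$ on $\mathbb{Z}$ such that for all $a,b$: $a\prec b$ iff $a+n\prec b+n$; $\mathrm{TTot}_n$ is the set of TITOs. $<$ denotes the usual order. $\mathrm{WO}(\mathrm{TTot}_n)$ is $\mathrm{TTot}_n$ partially ordered by $(\prec_1)\le(\prec_2)$ iff every pair $(a,b)$ with $a<b$ and $b\prec_1 a$ also satisfies $b\prec_2 a$. An arc is a tuple $(a,b,L,R)$ with $a<b$ integers and $L\sqcup R=\{a+1,\dots,b-1\}$. Two arcs $(a,b,L,R)$ and $(a',b',L',R')$ cross if $a=a'$, or $b=b'$, or both of the sets $(L\cap R')\cup(\{a,b\}\cap R')\cup(L\cap\{a',b'\})$ and $(R\cap L')\cup(\{a,b\}\cap L')\cup(R\cap\{a',b'\})$ are nonempty. A set of arcs is a non-crossing collection if no two distinct members cross. A wrapped pre-arc is an equivalence class of arcs under the equivalence relation generated by $(a,b,L,R)\sim(a+n,b+n,L+n,R+n)$. A wrapped arc is a wrapped pre-arc whose equivalence class is a non-crossing collection. A cyclic non-crossing collection is a set $D$ of wrapped arcs such that the union of all the equivalence classes in $D$ is a non-crossing collection of arcs. An arc $(a,b,L,R)$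 is a lower arc of a total order $\prec$ if $b\prec a$ with no $c$ satisfying $b\prec c\prec a$, $\ell\prec b$ for all $\ell\in L$, and $a\prec r$ for all $r\in R$. A wrapped pre-arc is a lower arc of a TITO $\prec$ if a (equivalently, any) representative $(a,b,L,R)$ is a lower arc of $\prec$; $\widetilde{\mathrm{LowerArcs}}(\prec)$ is the set of these. An element $x$ of a poset is widely generated if for all $y<x$ there is a cover relation $x'\lessdot x$ with $y\le x'$. *)

(* Defs.v *)
From HB Require Import structures.
From Stdlib Require Import Relation_Operators.
From mathcomp Require Import all_boot all_order all_algebra.
From mathcomp Require Import boolp classical_sets functions.

Set Implicit Arguments.
Unset Strict Implicit.
Unset Printing Implicit Defensive.

Import Order.TTheory GRing.Theory Num.Theory.
Local Open Scope classical_set_scope.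
Local Open Scope ring_scope.

Definition strict_total_order (T : Type) (r : T -> T -> Prop) : Prop :=
  [/\ forall x, ~ r x x,
      forall x y z, r x y -> r y z -> r x z &
      forall x y, x <> y -> r x y \/ r y x].

Record tito (n : nat) := Tito {
  prec :> int -> int -> Prop;
  tito_total : strict_total_order prec;
  tito_shift : forall a b : int, prec a b <-> prec (a + n%:Z) (b + n%:Z) }.

Definition wo_le (n : nat) (t1 t2 : tito n) : Prop :=
  forall a b : int, a < b -> t1 b a -> t2 b a.

Section WeakOrder.
Variable n : nat.
Implicit Types t : tito n.

Lemma tito_ext t1 t2 : (forall a b, t1 a b <-> t2 a b) -> t1 = t2.
Proof.
case: t1 t2 => [p1 T1 S1] [p2 T2 S2] /= e.
have {}e : p1 = p2 by apply/funext => a; apply/funext => b; apply/propext.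
by subst p2; rewrite (Prop_irrelevance T1 T2) (Prop_irrelevance S1 S2).
Qed.

Lemma wo_le_sub t1 t2 : wo_le t1 t2 -> wo_le t2 t1 ->
  forall a b, t1 a b -> t2 a b.
Proof.
move=> h12 h21 a b; case: (ltgtP a b) => [ab|ba|->] tab.
- have [irr1 tr1 _] := tito_total t1; have [_ _ tot2] := tito_total t2.
  have [//|tba] : t2 a b \/ t2 b a.
    by apply: tot2 => eab; rewrite eab ltxx in ab.
  by case: (irr1 a); apply: tr1 tab (h21 _ _ ab tba).
- exact: h12.
- by have [irr1 _ _] := tito_total t1; case: (irr1 b).
Qed.

Lemma wo_le_refl : reflexive (fun t1 t2 => `[< wo_le t1 t2 >]).
Proof. by move=> t; apply/asboolP. Qed.

Lemma wo_le_anti : antisymmetric (fun t1 t2 => `[< wo_le t1 t2 >]).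
Proof.
move=> t1 t2 /andP[/asboolP h12 /asboolP h21].
by apply: tito_ext => a b; split; apply: wo_le_sub.
Qed.

Lemma wo_le_trans : transitive (fun t1 t2 => `[< wo_le t1 t2 >]).
Proof.
move=> t2 t1 t3 /asboolP h12 /asboolP h23.
by apply/asboolP => a b ab /(h12 _ _ ab); apply: h23.
Qed.

End WeakOrder.

Fact wo_display : Order.disp_t. Proof. exact: (Order.Disp tt tt). Qed.

HB.instance Definition _ (n : nat) := gen_eqMixin (tito n).
HB.instance Definition _ (n : nat) := gen_choiceMixin (tito n).
HB.instance Definition _ (n : nat) := Order.Le_isPOrder.Build wo_display (tito n)
  (@wo_le_refl n) (@wo_le_anti n) (@wo_le_trans n).

Definition covered_by d (P : porderType d) (x y : P) : Prop :=
  (x < y)%O /\ forall z : P, ~ (x < z < y)%O.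

Definition widely_generated d (P : porderType d) (x : P) : Prop :=
  forall y : P, (y < x)%O -> exists2 x' : P, covered_by x' x & (y <= x')%O.

Record arc := Arc {
  arc_a : int;
  arc_b : int;
  arc_L : set int;
  arc_R : set int;
  arc_lt : arc_a < arc_b;
  arc_cup : arc_L `|` arc_R = [set c | arc_a < c < arc_b];
  arc_cap : arc_L `&` arc_R = set0 }.

Definition cross (x y : arc) : Prop :=
  let: Arc a b L R _ _ _ := x in
  let: Arc a' b' L' R' _ _ _ := y in
  [\/ a = a', b = b' |
      (L `&` R') `|` ([set a; b] `&` R') `|` (L `&` [set a'; b']) !=set0 /\
      (R `&` L') `|` ([set a; b] `&` L') `|` (R `&` [set a'; b']) !=set0].

Definition noncrossing (A : set arc) : Prop :=
  forall x y, A x -> A y -> x <> y -> ~ cross x y.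

Definition arc_shift (n : nat) (x y : arc) : Prop :=
  [/\ arc_a y = arc_a x + n%:Z, arc_b y = arc_b x + n%:Z,
      arc_L y = [set c + n%:Z | c in arc_L x] &
      arc_R y = [set c + n%:Z | c in arc_R x]].

Definition arc_equiv (n : nat) : arc -> arc -> Prop :=
  clos_refl_sym_trans arc (arc_shift n).

Definition wrapped_prearc (n : nat) (W : set arc) : Prop :=
  exists x, W = [set y | arc_equiv n x y].

Definition wrapped_arc (n : nat) (W : set arc) : Prop :=
  wrapped_prearc n W /\ noncrossing W.

Definition cyclic_noncrossing (n : nat) (D : set (set arc)) : Prop :=
  D `<=` [set W | wrapped_arc n W] /\ noncrossing (\bigcup_(W in D) W).

Definition lower_arc (r : int -> int -> Prop) (x : arc) : Prop :=
  let: Arc a b L R _ _ _ := x in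
  [/\ r b a, (forall c, ~ (r b c /\ r c a)),
      (forall l, L l -> r l b) & (forall c, R c -> r a c)].

(* [lower_arc t] is invariant under [arc_shift n] because t is, so asking for
   some representative in W is the same as asking for all of them. *)
Definition lower_arcs (n : nat) (t : tito n) : set (set arc) :=
  [set W | wrapped_prearc n W /\ exists2 x, W x & lower_arc t x].

(* Main.v *)
(* The inversion set of an arc (a, b, L, R) is the set of pairs p < q with p in
   R or p = a, and q in L or q = b.  Given a cyclic non-crossing collection, the
   transitive closure T of the union of the inversion sets of its arcs is
   biclosed, hence is the inversion set of a TITO; the non-crossing condition
   ensures that no generator of T cuts through an arc of the collection, so these
   arcs are the lower arcs of that TITO.
   Reversing all translates of an adjacent inversion b, a of a TITO gives a lower
   cover, and every lower cover loses such an inversion: if s < t differ at no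
   wall of s or t, they differ only at pairs lying at infinite distance in both
   orders, and translating one member of such a pair contradicts s < t.
   Hence t is widely generated iff it is the least order containing the
   inversion sets of its lower arcs. *)

From Stdlib Require Import Relation_Operators Operators_Properties.
From mathcomp Require Import all_boot all_order all_algebra.
From mathcomp Require Import boolp classical_sets functions.
From mathcomp Require Import zify.
Require Import Defs.

Set Implicit Arguments.
Unset Strict Implicit.
Unset Printing Implicit Defensive.

Import Order.TTheory GRing.Theory Num.Theory.
Local Open Scope ring_scope.

(** * Adjacent pairs (walls) and elementary facts about TITOs *)

Definition adjacent (r : int -> int -> Prop) (u v : int) : Prop :=
  r u v /\ forall c, ~ (r u c /\ r c v).

Section Tito.
Variable n : nat.
Implicit Types t : tito n.

Lemma tito_irr t a : ~ t a a.
Proof. by have [irr _ _] := tito_total t; apply: irr. Qed.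

Lemma tito_trans t b a c : t a b -> t b c -> t a c.
Proof. by have [_ tr _] := tito_total t; apply: tr. Qed.

Lemma tito_asym t a b : t a b -> ~ t b a.
Proof. by move=> ab ba; apply: (@tito_irr t a); apply: tito_trans ab ba. Qed.

Lemma tito_or t a b : a <> b -> t a b \/ t b a.
Proof. by have [_ _ tot] := tito_total t; apply: tot. Qed.

Lemma tito_not t a b : a <> b -> ~ t a b -> t b a.
Proof. by move=> ab nab; case: (tito_or t ab). Qed.

Lemma tito_neq t a b : t a b -> a <> b.
Proof. by move=> + e; rewrite e; apply: tito_irr. Qed.

Lemma tito_shiftz t (k a b : int) :
  t (a + k * n%:Z) (b + k * n%:Z) <-> t a b.
Proof.
have sh (m : nat) c d : t (c + m%:Z * n%:Z) (d + m%:Z * n%:Z) <-> t c d.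
  elim: m => [|m IH]; first by rewrite !mul0r !addr0.
  have e x : x + m.+1%:Z * n%:Z = x + m%:Z * n%:Z + n%:Z by lia.
  by rewrite !e -IH; apply: iff_sym; apply: tito_shift.
case: k => m; first exact: sh.
by rewrite NegzE -(sh m.+1) !mulNr !subrK.
Qed.

Lemma wo_leP t1 t2 : (t1 <= t2)%O <-> wo_le t1 t2.
Proof. by split=> /asboolP. Qed.

Lemma wo_le_eq t1 t2 : wo_le t1 t2 -> wo_le t2 t1 -> t1 = t2.
Proof. by move=> h1 h2; apply: tito_ext => a b; split; apply: wo_le_sub. Qed.

Lemma wo_ltP t1 t2 : (t1 < t2)%O <-> t1 <> t2 /\ wo_le t1 t2.
Proof.
rewrite lt_neqAle -wo_leP; split=> [/andP[/eqP]|[/eqP h1 h2]] //.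
by apply/andP.
Qed.

Lemma wo_lt_diff t1 t2 : t1 <> t2 -> wo_le t1 t2 ->
  exists p q, [/\ p < q, t1 p q & t2 q p].
Proof.
move=> neq le; apply: contrapT => H; apply: neq; apply: wo_le_eq => // a b ab t2ba.
apply: contrapT => n1; apply: H; exists a, b; split=> //.
by apply: tito_not n1; lia.
Qed.

(** * Intervals of a TITO *)

(** Induction on the size of [s]: any [c] inside the interval splits it in two, and since [f] is
    injective there, [f c] can be deleted from the list for both halves. *)
Lemma chain_of_finite_interval t (f : int -> int) (s : seq int) u v : t u v ->
    (forall c, t u c -> t c v -> f c \in s) ->
    (forall c d, t u c -> t c v -> t u d -> t d v -> f c = f d -> c = d) ->
  clos_trans int (adjacent t) u v.
Proof.
have [m] := ubnP (size s); elim: m s u v => // m IH s u v szs uv fs finj.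
have [[c [uc cv]]|no] := pselect (exists c, t u c /\ t c v); last first.
  by apply: t_step; split=> // c cP; apply: no; exists c.
have fcs := fs c uc cv.
have szr : (size (rem (f c) s) < m)%N.
  by rewrite size_rem //; case: (s) fcs szs => //= *; lia.
have rmem d : f d \in s -> f d <> f c -> f d \in rem (f c) s.
  move=> ds /eqP dc; move: ds; rewrite (perm_mem (perm_to_rem fcs)) inE.
  by rewrite (negPf dc).
apply: (t_trans _ _ _ c); apply: (IH (rem (f c) s)) => //.
- move=> d ud dc; have dv := tito_trans dc cv.
  by apply: rmem; [apply: fs|move/finj => e; apply: (tito_neq dc); apply: e].
- by move=> d e ud dc ue ec; apply: finj => //; apply: tito_trans cv.
- move=> d cd dv; have ud := tito_trans uc cd.
  by apply: rmem; [apply: fs|move/finj => e; apply: (tito_neq cd); rewrite e].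
- by move=> d e cd dv ce ev; apply: finj => //; apply: tito_trans uc _.
Qed.

(** Since c precedes lo + k n, which precedes c + k n, translation by k n moves c upward, so no
    further translate in that direction returns to the interval from lo to lo + k n. *)
Lemma translate_above t (k lo c : int) (j : nat) :
  t lo c -> t c (lo + k * n%:Z) ->
  t (lo + k * n%:Z) (c + j.+1%:Z * k * n%:Z).
Proof.
move=> loc clo.
have cs (i : nat) : t (c + i%:Z * k * n%:Z) (c + i.+1%:Z * k * n%:Z).
  have -> : c + i.+1%:Z * k * n%:Z = (c + k * n%:Z) + (i%:Z * k) * n%:Z by lia.
  by apply/tito_shiftz; apply: tito_trans clo _; apply/tito_shiftz.
elim: j => [|j IH]; first by rewrite mul1r; apply/tito_shiftz.
exact: tito_trans IH (cs _).
Qed.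

(* Two elements of such an interval cannot be congruent modulo k n, so the
   interval is finite. *)
Lemma chain_in_period t (k lo u v : int) : t u v ->
    lo = u \/ t lo u -> v = lo + k * n%:Z \/ t v (lo + k * n%:Z) ->
  clos_trans int (adjacent t) u v.
Proof.
move=> uv lou vhi; set m := k * n%:Z.
have btw c : t u c -> t c v -> t lo c /\ t c (lo + m).
  move=> uc cv; split; first by case: lou => [->|h] //; apply: tito_trans uc.
  by case: vhi => [<-|h] //; apply: tito_trans h.
have m0 : m != 0.
  apply/eqP => m0; move: vhi; rewrite -/m m0 addr0 => vhi.
  have lov : t lo v by case: lou => [->|h] //; apply: tito_trans h uv.
  by case: vhi => [/esym|/(tito_asym lov)//]; apply: tito_neq lov.
apply: (@chain_of_finite_interval t (fun c => (c %% m)%Z)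
          [seq i%:Z | i <- iota 0 `|m|%N]) => // [c _ _|c d uc cv ud dv].
  have h0 : 0 <= (c %% m)%Z by rewrite modz_ge0.
  have h1 : (c %% m)%Z < `|m|%:Z by rewrite ltz_mod.
  by apply/mapP; exists `|(c %% m)%Z|%N; [rewrite mem_iota|]; lia.
have [loc chi] := btw c uc cv; have [lod dhi] := btw d ud dv.
move=> /eqP; rewrite eqz_mod_dvd => /dvdzP[j e].
have {e} e : c = d + j * k * n%:Z by rewrite -mulrA -/m; lia.
case: j e => [[|j]|j] e.
- by rewrite e; lia.
- case: (tito_asym chi); rewrite e; exact: (translate_above j lod dhi).
- case: (tito_asym dhi).
  have -> : d = c + j.+1%:Z * k * n%:Z by rewrite e NegzE; lia.
  exact: (translate_above j loc chi).
Qed.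

Lemma chain_step (r s : int -> int -> Prop) u v :
    (forall b a c, s a b -> s b c -> s a c) -> clos_trans int r u v -> ~ s u v ->
  exists c d, r c d /\ ~ s c d.
Proof.
move=> tr rt ns; apply: contrapT => no; apply: ns.
elim: rt => {u v} [u v uv|u w v _ suw _]; last exact: tr.
by apply: contrapT => ns; apply: no; exists u, v.
Qed.

(* Some inversion of t2 that is not one of t1 is a wall of t2 or of t1.
   Otherwise a pair p < q in which they differ lies at infinite distance in both
   orders, so p + k n and q differ as well for every k; but for large k this makes
   (q, p + k n) an inversion of t1 and not of t2. *)
Lemma wall_between t1 t2 : (0 < n)%N -> t1 <> t2 -> wo_le t1 t2 ->
  (exists a b, [/\ a < b, adjacent t2 b a & t1 a b]) \/
  (exists a b, [/\ a < b, adjacent t1 a b & t2 b a]).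
Proof.
move=> n0 neq le; have [p [q [pq t1pq t2qp]]] := wo_lt_diff neq le.
(* As n is positive, this [k] moves p beyond q in the usual order. *)
pose k : int := q - p + 1.
have qpk : q < p + k * n%:Z by rewrite /k; nia.
have [qk|kq] := tito_or t2 (a := q) (b := p + k * n%:Z) ltac:(lia).
- right.
  (* The pair (q, p + k n) is not an inversion of [t2], hence not of [t1], so in [t1] the interval
     from p to q lies within one period. *)
  have qk1 : t1 q (p + k * n%:Z).
    by apply: tito_not => [|h]; [lia|apply: (tito_asym qk); apply: le].
  have ch : clos_trans int (adjacent t1) p q.
    by apply: (chain_in_period (k := k) t1pq (lo := p)); [left|right].
  have [c [d [adj ncd]]] := chain_step (@tito_trans t2) ch (tito_asym t2qp).
  exists c, d; have t2dc := tito_not (tito_neq adj.1) ncd; split=> //.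
  by have [|dc|e] := ltgtP c d => //; [case: ncd; apply: le adj.1|case: (tito_neq adj.1)].
- left.
  (* Here the window of [t2] starts at p + k n and ends at p, so the period is - k. *)
  have ch : clos_trans int (adjacent t2) q p.
    apply: (chain_in_period (k := - k) t2qp (lo := p + k * n%:Z)); first by right.
    by left; lia.
  have [c [d [adj ncd]]] := chain_step (@tito_trans t1) ch (tito_asym t1pq).
  exists d, c; have t1dc := tito_not (tito_neq adj.1) ncd; split=> //.
  have [cd||e] := ltgtP c d => //; last by case: (tito_neq adj.1).
  by case: (tito_asym adj.1); apply: le t1dc.
Qed.

(** * Reversing the translates of an adjacent pair *)

Section Flip.
Variables (t : tito n) (u v : int).

Definition step (c d : int) : Prop :=
  exists k : int, c = u + k * n%:Z /\ d = v + k * n%:Z.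

Definition run : int -> int -> Prop := clos_refl_trans int step.

(* The maximal runs are the pairs {u + k n, v + k n} if u and v are not congruent
   modulo n, and the whole residue class of u otherwise. *)
Definition flip_rel (c d : int) : Prop :=
  (run d c /\ c <> d) \/ (t c d /\ ~ run c d).

(** The order [s] is arbitrary so that the lemma also serves for orders compared with [t] and its
    flip. *)
Lemma run_tito (s : tito n) c d : s u v -> run c d -> c = d \/ s c d.
Proof.
move=> suv; elim=> {c d} [c d [k [-> ->]]|c|c e d _ ce _ ed].
- by right; apply/tito_shiftz.
- by left.
- case: ce ed => [->|ce] [<-|ed]; [by left|by right..|].
  by right; apply: tito_trans ce ed.
Qed.

Lemma run_tito_rev (s : tito n) c d : s v u -> run c d -> c = d \/ s d c.
Proof.
move=> suv; elim=> {c d} [c d [k [-> ->]]|c|c e d _ ce _ ed].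
- by right; apply/tito_shiftz.
- by left.
- case: ce ed => [->|ce] [<-|ed]; [by left|by right..|].
  by right; apply: tito_trans ed ce.
Qed.

Lemma run_le c d : u < v -> run c d -> c <= d.
Proof. by move=> uv; elim=> {c d} [c d [k [-> ->]]|c|c e d _ ce _ ed]; lia. Qed.

Lemma run_ge c d : v < u -> run c d -> d <= c.
Proof. by move=> uv; elim=> {c d} [c d [k [-> ->]]|c|c e d _ ce _ ed]; lia. Qed.

Lemma run_shift (m c d : int) : run c d -> run (c + m * n%:Z) (d + m * n%:Z).
Proof.
elim=> {c d} [c d [k [-> ->]]|c|c e d _ ce _ ed].
- by apply: rt_step; exists (k + m); split; lia.
- exact: rt_refl.
- exact: rt_trans ce ed.
Qed.

Lemma run_shiftE c d : run c d <-> run (c + n%:Z) (d + n%:Z).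
Proof.
split=> [/(run_shift 1)|/(run_shift (- 1))]; first by rewrite mul1r.
by rewrite !mulN1r !addrK.
Qed.

Hypothesis uv : adjacent t u v.

Lemma step_adjacent c d : step c d -> adjacent t c d.
Proof.
move=> [k [-> ->]]; split=> [|e]; first by apply/tito_shiftz; apply: uv.1.
rewrite -[e](subrK (k * n%:Z)) => -[/tito_shiftz h1 /tito_shiftz h2].
exact: (uv.2 _ (conj h1 h2)).
Qed.

(** Each step is a translate of the adjacent pair (u, v), so nothing of [t] lies strictly inside it;
    runs are therefore intervals of [t]. *)
Lemma run_convex c e d : run c d -> t c e -> t e d -> run c e /\ run e d.
Proof.
move/(clos_rt_rt1n int step) => r; elim: r e => {c d} [c e ce /(tito_asym ce)//|].
move=> c c' d cc' /(clos_rt1n_rt int step) c'd IH e ce ed.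
have [cc'1 no] := step_adjacent cc'.
have [<-|ec'] := eqVneq c' e; first by split=> //; apply: rt_step.
have [c'e|/(conj ce)/no//] := tito_or t (elimN eqP ec').
have [r1 r2] := IH e c'e ed; split=> //.
by apply: rt_trans r1; apply: rt_step.
Qed.

(** Runs are intervals of [t], so reversing each one in place keeps a total order; convexity settles
    the cases of transitivity that mix reversed and kept pairs. *)
Lemma flip_total : strict_total_order flip_rel.
Proof.
have rt c d : run c d -> c <> d -> t c d by move=> /(run_tito uv.1)[].
split=> [x [[]//|[/tito_irr//]]|x y z|x y].
- case=> [[yx nxy]|[xy nxy]] [[zy nyz]|[yz nyz]].
  + left; split; first exact: rt_trans zy yx.
    have tyx := rt _ _ yx (nesym nxy); have tzy := rt _ _ zy (nesym nyz).
    by move=> e; apply: (tito_asym tyx); rewrite e.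
  + have tyx := rt _ _ yx (nesym nxy); right.
    have txz : t x z.
      apply: contrapT => ntxz; apply: nyz; have [<- //|xz] := eqVneq x z.
      by have [] := run_convex yx yz (tito_not (elimN eqP xz) ntxz).
    by split=> // xz; apply: nyz; apply: rt_trans yx xz.
  + have tzy := rt _ _ zy (nesym nyz); right.
    have txz : t x z.
      apply: contrapT => ntxz; apply: nxy; have [-> //|xz] := eqVneq x z.
      by have [] := run_convex zy (tito_not (elimN eqP xz) ntxz) xy.
    by split=> // xz; apply: nxy; apply: rt_trans xz zy.
  + right; split; first exact: tito_trans xy yz.
    by move=> xz; have [] := run_convex xz xy yz.
- move=> xy; wlog txy : x y xy / t x y.
    move=> H; have [|tyx] := tito_or t xy; first exact: H.
    by case: (H y x (nesym xy) tyx); [right|left].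
  have [r|nr] := pselect (run x y); last by left; right.
  by right; left; split=> //; apply: nesym.
Qed.

Lemma flip_shift a b : flip_rel a b <-> flip_rel (a + n%:Z) (b + n%:Z).
Proof.
have nab : a <> b <-> a + n%:Z <> b + n%:Z by lia.
by rewrite /flip_rel -!run_shiftE -tito_shift -nab.
Qed.

Definition flip : tito n := Tito flip_total flip_shift.

Lemma flip_vu : flip v u.
Proof.
left; split; first by apply: rt_step; exists 0; rewrite !mul0r !addr0.
exact: nesym (tito_neq uv.1).
Qed.

(** An order with v before u reverses every run, so none of its inversions is among those that the
    flip removes. *)
Lemma le_flip_down (s : tito n) : wo_le s t -> s v u -> wo_le s flip.
Proof.
move=> st svu a b ab sba; right; split; first exact: st.
by move=> /(run_tito_rev svu)[/(tito_neq sba)|/(tito_asym sba)].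
Qed.

(** An order z between the flip and [t] either has u before v, hence orders all runs as [t] does and
    equals [t], or has v before u and then lies below the flip. *)
Lemma flip_down_cover : v < u -> covered_by flip t.
Proof.
move=> vu; have flip_t : wo_le flip t.
  by move=> a b ab [[/(run_ge vu) h _]|[]//]; lia.
split=> [|z /andP[/wo_ltP[nfz fz] /wo_ltP[nzt zt]]].
  by apply/wo_ltP; split=> // e; apply: (tito_asym uv.1); rewrite -{1}e; apply: flip_vu.
have [zuv|zvu] := tito_or z (tito_neq uv.1).
- apply: nzt; apply: wo_le_eq => // a b ab tba.
  have [r|nr] := pselect (run b a); last by apply: fz => //; right.
  by case: (run_tito zuv r) => // /(tito_neq tba).
- by apply: nfz; apply: wo_le_eq => //; apply: le_flip_down.
Qed.

Lemma le_flip_up : u < v -> wo_le t flip.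
Proof. by move=> lt a b ab tba; right; split=> // /(run_le lt); lia. Qed.

Lemma flip_up_le (s : tito n) : wo_le t s -> s v u -> wo_le flip s.
Proof.
move=> ts svu a b ab [[/(run_tito_rev svu)[/esym|]//]|[tba _]]; exact: ts.
Qed.

Lemma flip_adjacent : adjacent flip v u.
Proof.
split=> [|c]; first exact: flip_vu.
have ruv : run u v by apply: rt_step; exists 0; rewrite !mul0r !addr0.
have rt a b : run a b -> a <> b -> t a b by move=> /(run_tito uv.1)[].
case=> -[[cv /nesym nvc]|[vc nvc]] [[uc /nesym ncu]|[cu ncu]].
- exact: (uv.2 _ (conj (rt _ _ uc ncu) (rt _ _ cv nvc))).
- by apply: ncu; have [] := run_convex cv cu uv.1.
- by apply: nvc; have [] := run_convex uc uv.1 vc.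
- by apply: (tito_asym uv.1); apply: tito_trans vc cu.
Qed.

End Flip.

(** * Lower covers and walls *)

Lemma wall_cover (s t : tito n) a b : a < b -> adjacent t b a ->
  wo_le s t -> s a b -> exists2 x, covered_by x t & wo_le s x.
Proof.
move=> ab adj st sab; exists (flip adj); first exact: flip_down_cover.
exact: le_flip_down.
Qed.

(** If the wall found belongs to [s], reversing its translates gives an order strictly above [s] and
    below [t], which must be [t] itself; the reversed pair is then adjacent in [t]. *)
Lemma cover_wall (s t : tito n) : (0 < n)%N -> covered_by s t ->
  exists a b, [/\ a < b, adjacent t b a & s a b].
Proof.
move=> n0 [/wo_ltP[nst st] no].
case: (wall_between n0 nst st) => // -[a [b [ab adj tba]]].
have sab := adj.1; have e : flip adj = t.
  apply: contrapT => ne; apply: (no (flip adj)); apply/andP; split; apply/wo_ltP.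
    split; last exact: le_flip_up.
    move=> e; apply: (tito_asym adj.1); rewrite {1}e; exact: flip_vu.
  by split=> //; apply: flip_up_le.
by exists a, b; split=> //; rewrite -e; apply: flip_adjacent.
Qed.

(** * Total orders from biclosed sets of pairs *)

(** The order [r] inverts exactly the pairs of [I]; transitivity of [r] comes from [I] being both
    transitive and co-transitive. *)
Lemma biclosed_tito (I : int -> int -> Prop) :
    (forall a b, I a b -> a < b) ->
    (forall a b c, I a b -> I b c -> I a c) ->
    (forall a b c, I a c -> a < b -> b < c -> I a b \/ I b c) ->
    (forall a b, I a b <-> I (a + n%:Z) (b + n%:Z)) ->
  exists t : tito n, forall a b, a < b -> (t b a <-> I a b).
Proof.
move=> Ilt Itr Ico Ish; pose r a b := (a < b /\ ~ I a b) \/ I b a.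
have rtot : strict_total_order r.
  split=> [x [[]|/Ilt]|x y z|x y xy]; [by rewrite ltxx..| |].
  - case=> [[xy nxy]|yx] [[yz nyz]|zy].
    + by left; split=> [|/Ico]; [lia|case/(_ y)].
    + have := Ilt _ _ zy; case: (ltgtP x z) => [xz zy'|zx _|e _].
      * by left; split=> // Ixz; apply: nxy; apply: Itr Ixz zy.
      * by right; case: (Ico _ x _ zy zx xy).
      * by case: nxy; rewrite e.
    + have := Ilt _ _ yx; case: (ltgtP x z) => [xz yx'|zx yx'|e _].
      * by left; split=> // Ixz; apply: nyz; apply: Itr yx Ixz.
      * by right; case: (Ico _ z _ yx yz zx).
      * by case: nyz; rewrite -e.
    + by right; apply: Itr zy yx.
  - wlog lt : x y xy / x < y.
      move=> H; case: (ltgtP x y) => [|lt|//]; first exact: H.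
      by case: (H y x _ lt); [lia|right|left].
    by have [h|h] := pselect (I x y); [right; right|left; left].
have rsh a b : r a b <-> r (a + n%:Z) (b + n%:Z).
  by rewrite /r -!Ish ltrD2r.
exists (Tito rtot rsh) => a b ab; split=> [[[]|//]|]; [lia|by right].
Qed.

End Tito.

(** * Arcs *)

Lemma arc_interior x c : arc_a x < c < arc_b x <-> arc_L x c \/ arc_R x c.
Proof.
case: x => a b L R lt cup cap /=.
by rewrite -[L c \/ R c]/((L `|` R)%classic c) cup.
Qed.

Lemma arc_disjoint x c : arc_L x c -> ~ arc_R x c.
Proof.
case: x => a b L R lt cup cap /= Lc Rc.
by have : (L `&` R)%classic c by []; rewrite cap.
Qed.

Lemma arc_ext x y : arc_a x = arc_a y -> arc_b x = arc_b y ->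
  arc_L x = arc_L y -> arc_R x = arc_R y -> x = y.
Proof.
case: x y => a b L R lt cup cap [a' b' L' R' lt' cup' cap'] /= ? ? ? ?.
subst a' b' L' R'; congr Arc; exact: Prop_irrelevance.
Qed.

(** Emptiness of the first of the two sets in [cross]; exchanging [x] and [y] gives emptiness of the
    second. *)
Definition separated (x y : arc) : Prop := forall c,
  (arc_L x c -> ~ [\/ arc_R y c, c = arc_a y | c = arc_b y]) /\
  (c = arc_a x \/ c = arc_b x -> ~ arc_R y c).

Lemma crossP x y : cross x y <-> [\/ arc_a x = arc_a y, arc_b x = arc_b y |
  ~ separated x y /\ ~ separated y x].
Proof.
case: x y => a b L R lt cup cap [a' b' L' R' lt' cup' cap'].
have h1 : ((L `&` R') `|` ([set a; b] `&` R') `|` (L `&` [set a'; b']) !=set0)%classic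
    <-> ~ separated (Arc lt cup cap) (Arc lt' cup' cap').
  split=> [[c H] /(_ c) /= sep|nsep].
    by move: H => /= [[[]|[]]|[Lc [e|e]]]; move: sep => [s1 s2];
      [move=> /s1 h R'c; apply: h; constructor|exact: s2|
       apply: (s1 Lc); constructor 2|apply: (s1 Lc); constructor 3].
  apply: contrapT => no; apply: nsep => c /=; split=> [Lc H|H R'c]; apply: no; exists c.
    by case: H => H; [left; left|right; split=> //; left|right; split=> //; right].
  by left; right; split.
have h2 : ((R `&` L') `|` ([set a; b] `&` L') `|` (R `&` [set a'; b']) !=set0)%classic
    <-> ~ separated (Arc lt' cup' cap') (Arc lt cup cap).
  split=> [[c H] /(_ c) /= sep|nsep].
    by move: H => /= [[[Rc L'c]|[H L'c]]|[Rc H]]; move: sep => [s1 s2];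
      [apply: (s1 L'c); constructor|
       apply: (s1 L'c); case: H => H; [constructor 2|constructor 3]|
       exact: (s2 H)].
  apply: contrapT => no; apply: nsep => c /=; split=> [L'c H|H Rc]; apply: no; exists c.
    by case: H => H; [left; left|left; right; split=> //; left|left; right; split=> //; right].
  by right; split.
by rewrite /= (propext h1) (propext h2).
Qed.

Lemma lower_arcP r x : lower_arc r x <->
  [/\ adjacent r (arc_b x) (arc_a x), (forall l, arc_L x l -> r l (arc_b x)) &
      (forall c, arc_R x c -> r (arc_a x) c)].
Proof. by case: x => a b L R lt cup cap /=; split=> [[? ? ? ?]|[[? ?] ? ?]]. Qed.

(** * Lower arcs of a TITO do not cross *)

Section LowerArcs.
Variable n : nat.
Implicit Types t : tito n.

Lemma lower_arc_LE t x c : lower_arc t x ->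
  arc_L x c <-> arc_a x < c < arc_b x /\ t c (arc_b x).
Proof.
move=> /lower_arcP[adj Lx Rx]; split=> [Lc|[/arc_interior[]// /Rx ac cb]].
  by split; [apply/arc_interior; left|apply: Lx].
by case: (tito_asym adj.1); apply: tito_trans ac cb.
Qed.

Lemma lower_arc_RE t x c : lower_arc t x ->
  arc_R x c <-> arc_a x < c < arc_b x /\ t (arc_a x) c.
Proof.
move=> /lower_arcP[adj Lx Rx]; split=> [Rc|[/arc_interior[]// /Lx cb ac]].
  by split; [apply/arc_interior; right|apply: Rx].
by case: (tito_asym adj.1); apply: tito_trans ac cb.
Qed.

Lemma lower_arc_eq t x y : lower_arc t x -> lower_arc t y ->
  arc_a x = arc_a y -> arc_b x = arc_b y -> x = y.
Proof.
move=> lx ly ea eb; apply: arc_ext => //; apply/funext => c; apply/propext.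
  by rewrite (lower_arc_LE c lx) (lower_arc_LE c ly) ea eb.
by rewrite (lower_arc_RE c lx) (lower_arc_RE c ly) ea eb.
Qed.

Lemma lower_arc_a_inj t x y : lower_arc t x -> lower_arc t y ->
  arc_a x = arc_a y -> x = y.
Proof.
move=> lx ly e; apply: (lower_arc_eq lx ly e).
have /lower_arcP[[xab nox] _ _] := lx; have /lower_arcP[[yab noy] _ _] := ly.
rewrite -{}e in yab noy.
apply: contrapT => ne; case: (tito_or t ne) => h; first exact: (nox _ (conj h yab)).
exact: (noy _ (conj h xab)).
Qed.

Lemma lower_arc_b_inj t x y : lower_arc t x -> lower_arc t y ->
  arc_b x = arc_b y -> x = y.
Proof.
move=> lx ly e; apply: (lower_arc_eq lx ly) => //.
have /lower_arcP[[xab nox] _ _] := lx; have /lower_arcP[[yab noy] _ _] := ly.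
rewrite -{}e in yab noy.
apply: contrapT => ne; case: (tito_or t ne) => h; first exact: (noy _ (conj xab h)).
exact: (nox _ (conj yab h)).
Qed.

(** The adjacent pair of [x] comes before that of [y], possibly sharing one point. The left side of
    [x] precedes its pair and the right side of [y] follows its own, so they cannot meet. *)
Lemma lower_arc_separated t x y : lower_arc t x -> lower_arc t y ->
  arc_a x = arc_b y \/ t (arc_a x) (arc_b y) -> separated x y.
Proof.
move=> /lower_arcP[[xab _] Lx Rx] /lower_arcP[[yab _] Ly Ry] xy c.
have bxy : t (arc_b x) (arc_b y).
  by case: xy => [<-//|h]; apply: tito_trans xab h.
have axay : t (arc_a x) (arc_a y).
  by case: xy => [->//|h]; apply: tito_trans h yab.
split=> [/Lx cb|cx /Ry yc].
  have cby := tito_trans cb bxy; have cay := tito_trans cby yab.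
  by case=> [/Ry/(tito_asym cay)|/(tito_neq cay)|/(tito_neq cby)].
by case: cx yc => -> yc; apply: (tito_asym yc) => //; apply: tito_trans bxy yab.
Qed.

Lemma lower_arcs_not_cross t x y : lower_arc t x -> lower_arc t y ->
  x <> y -> ~ cross x y.
Proof.
move=> lx ly nxy /crossP[/(lower_arc_a_inj lx ly)//|/(lower_arc_b_inj lx ly)//|].
have /lower_arcP[[xab nox] _ _] := lx; have /lower_arcP[[yab noy] _ _] := ly.
have [e|ne] := eqVneq (arc_a x) (arc_b y).
  by case=> [[]]; apply: (lower_arc_separated lx ly); left.
have [h|h] := tito_or t (elimN eqP ne).
  by case=> [[]]; apply: (lower_arc_separated lx ly); right.
have [e|ne'] := eqVneq (arc_a y) (arc_b x).
  by case=> _ []; apply: (lower_arc_separated ly lx); left.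
have [h'|h'] := tito_or t (elimN eqP ne').
  by case=> _ []; apply: (lower_arc_separated ly lx); right.
(* Neither pair precedes the other, so the later starting points interlace and one [arc_a] falls
   strictly inside the other adjacent pair. *)
have neq : arc_a x <> arc_a y by move/(lower_arc_a_inj lx ly).
by case: (tito_or t neq) => H; [case: (noy (arc_a x))|case: (nox (arc_a y))].
Qed.

(** * Translation of arcs and invariance of lower arcs *)

Lemma arc_translate_ltP (m : int) x : arc_a x + m < arc_b x + m.
Proof. by rewrite ltrD2r; case: x. Qed.

Lemma arc_translate_cupP (m : int) x :
  ([set c | arc_L x (c - m)] `|` [set c | arc_R x (c - m)] =
   [set c | arc_a x + m < c < arc_b x + m])%classic.
Proof.
apply/funext => c; apply/propext.
rewrite /= -(propext (arc_interior x (c - m))).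
by rewrite ltrBrDr ltrBlDr.
Qed.

Lemma arc_translate_capP (m : int) x :
  ([set c | arc_L x (c - m)] `&` [set c | arc_R x (c - m)] = set0)%classic.
Proof.
by apply/funext => c; apply/propext; split=> // -[] /= /arc_disjoint.
Qed.

(** The sides are preimages rather than images, so that membership reduces to membership in the
    sides of [x]. *)
Definition arc_translate (m : int) (x : arc) : arc :=
  Arc (arc_translate_ltP m x) (arc_translate_cupP m x) (arc_translate_capP m x).

Lemma image_translate (m : int) (A : set int) c :
  ([set c + m | c in A]%classic c) <-> A (c - m).
Proof.
split=> [[d Ad <-]|Ac]; first by rewrite addrK.
by exists (c - m) => //; rewrite subrK.
Qed.

Lemma arc_shift_translate x : arc_shift n x (arc_translate n%:Z x).
Proof.
by split=> //=; apply/funext => c; apply/propext; rewrite image_translate.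
Qed.

Lemma arc_translate_shift x : arc_shift n (arc_translate (- n%:Z) x) x.
Proof.
split=> /=; rewrite ?subrK //; apply/funext => c; apply/propext;
  by rewrite image_translate /= opprK subrK.
Qed.

Lemma lower_arc_shift t x y : arc_shift n x y -> lower_arc t x <-> lower_arc t y.
Proof.
case=> ea eb eL eR; rewrite !lower_arcP ea eb eL eR.
have adjE : adjacent t (arc_b x) (arc_a x) <->
    adjacent t (arc_b x + n%:Z) (arc_a x + n%:Z).
  rewrite /adjacent -tito_shift; split=> -[h no]; split=> // c.
    rewrite -[c](subrK n%:Z) -!tito_shift; exact: no.
  rewrite (tito_shift t _ c) (tito_shift t c); exact: no.
rewrite -(propext adjE); split=> -[adj Lx Rx]; split=> // c.
- by case=> d /Lx h <-; rewrite -tito_shift.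
- by case=> d /Rx h <-; rewrite -tito_shift.
- by move=> Lc; rewrite tito_shift; apply: Lx; exists c.
- by move=> Rc; rewrite tito_shift; apply: Rx; exists c.
Qed.

Lemma lower_arc_equiv t x y : arc_equiv n x y -> lower_arc t x <-> lower_arc t y.
Proof.
by elim=> {x y} [x y /lower_arc_shift||x y _ IH|x y z _ IH1 _ IH2] //;
  [rewrite IH|rewrite IH1 IH2].
Qed.

Lemma lower_arcs_mem t W x : lower_arcs t W -> W x -> lower_arc t x.
Proof.
move=> [[y ->] [z yz lz]] yx; rewrite -(lower_arc_equiv t yx).
by rewrite (lower_arc_equiv t yz).
Qed.

Lemma lower_arcs_cyclic_noncrossing t : cyclic_noncrossing n (lower_arcs t).
Proof.
split=> [W lW|x y [W lW Wx] [W' lW' W'y] nxy].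
  split=> [|x y Wx Wy nxy]; first by case: lW.
  exact: lower_arcs_not_cross (lower_arcs_mem lW Wx) (lower_arcs_mem lW Wy) nxy.
exact: lower_arcs_not_cross (lower_arcs_mem lW Wx) (lower_arcs_mem lW' W'y) nxy.
Qed.

End LowerArcs.

(** * The order generated by a non-crossing collection *)

Section Join.
Variable A : set arc.

(* For a single arc this is the inversion set of the join-irreducible order
   which has that arc as its only lower arc. *)
Definition arc_inv (x : arc) (p q : int) : Prop :=
  [/\ p < q, p = arc_a x \/ arc_R x p & q = arc_b x \/ arc_L x q].

Definition coll_inv (p q : int) : Prop := exists2 x, A x & arc_inv x p q.

Definition join_inv : int -> int -> Prop := clos_trans int coll_inv.

Lemma arc_L_lt x c : arc_L x c -> arc_a x < c < arc_b x.
Proof. by move=> Lc; apply/arc_interior; left. Qed.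

Lemma arc_R_lt x c : arc_R x c -> arc_a x < c < arc_b x.
Proof. by move=> Rc; apply/arc_interior; right. Qed.

Lemma arc_inv_ab x : arc_inv x (arc_a x) (arc_b x).
Proof. by split; [case: x|left|left]. Qed.

(** An intermediate r is interior to the arc: on the left side it can serve as an upper end of an
    inversion, on the right side as a lower end. *)
Lemma arc_inv_split x p r q : arc_inv x p q -> p < r -> r < q ->
  (arc_L x r /\ arc_inv x p r) \/ (arc_R x r /\ arc_inv x r q).
Proof.
move=> [pq px qx] pr rq.
have ap : arc_a x <= p by case: px => [->|/arc_R_lt] //; lia.
have qb : q <= arc_b x by case: qx => [->|/arc_L_lt] //; lia.
have : arc_a x < r < arc_b x by lia.
by move=> /arc_interior[h|h]; [left|right]; do 2?split=> //; right.
Qed.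

Lemma join_inv_lt p q : join_inv p q -> p < q.
Proof. by elim=> {p q} [p q [x _ []]//|p m q _ h1 _ h2]; apply: lt_trans h2. Qed.

(* Co-transitivity of the generators passes to their transitive closure. *)
Lemma join_inv_cotrans p r q : join_inv p q -> p < r -> r < q ->
  join_inv p r \/ join_inv r q.
Proof.
move=> h; elim: h r => {p q} [p q [x Ax pq]|p m q pm IH1 mq IH2] r pr rq.
  by case: (arc_inv_split pq pr rq) => -[_ h]; [left|right]; apply: t_step; exists x.
case: (ltgtP r m) => [rm|mr|->]; last by left.
- by case: (IH1 r pr rm) => h; [left|right; apply: t_trans h mq].
- by case: (IH2 r mr rq) => h; [left; apply: t_trans pm h|right].
Qed.

Lemma join_inv_le n (t : tito n) p q : (forall x, A x -> lower_arc t x) ->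
  join_inv p q -> t q p.
Proof.
move=> lowA; elim=> {p q} [p q [x /lowA/lower_arcP[[ba _] Lx Rx] [_ px qx]]|p m q _ h1 _ h2].
  have bp : t (arc_b x) p by case: px => [->//|/Rx]; apply: tito_trans ba.
  by case: qx => [->//|/Lx h]; apply: tito_trans h bp.
exact: tito_trans h2 h1.
Qed.

Hypothesis ncA : noncrossing A.

Lemma noncrossing_separated x y : A x -> A y -> x <> y ->
  [/\ arc_a x <> arc_a y, arc_b x <> arc_b y & separated x y \/ separated y x].
Proof.
move=> Ax Ay nxy; have nc := ncA Ax Ay nxy.
split=> [e|e|]; try by apply: nc; apply/crossP; constructor.
apply: contrapT => h; apply: nc; apply/crossP; constructor 3.
by split=> s; apply: h; [left|right].
Qed.

(** * Generated inversions relative to a fixed arc of the collection *)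

Section OneArc.
Variable x : arc.
Hypothesis Ax : A x.

(** No generator cuts through [x]. For [x] itself the two sides are disjoint; for another arc,
    separation in one direction excludes p and in the other direction q. *)
Lemma coll_inv_exit p q : coll_inv p q ->
    p = arc_a x \/ arc_L x p -> q = arc_b x \/ arc_R x q ->
  p = arc_a x /\ q = arc_b x.
Proof.
move=> [y Ay [pq py qy]] px qx.
have [e|nxy] := pselect (x = y).
  by subst y; split; [case: px py => // /arc_disjoint h [//|/h]|
    case: qy qx => // /arc_disjoint h [//|/h]].
have [na nb [sep|sep]] := noncrossing_separated Ax Ay nxy.
- have [s1 s2] := sep p; case: px => [px|/s1[]];
    last by case: py => h; [constructor 2|constructor].
  by case: py => [py|/s2 []//]; [case: na; rewrite -px -py|left].
- have [s1 s2] := sep q; case: qy => [qy|/s1[]];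
    last by case: qx => h; [constructor 3|constructor].
  by case: qx => [qx|/s2 []//]; [case: nb; rewrite -qx -qy|right].
Qed.

(** An intermediate point m lies on one side of [x]; induction on the half of the chain after m
    (left side) or before m (right side) would make m an endpoint of [x]. *)
Lemma join_inv_exit p q : join_inv p q ->
    p = arc_a x \/ arc_L x p -> q = arc_b x \/ arc_R x q ->
  p = arc_a x /\ q = arc_b x.
Proof.
elim=> {p q} [p q|p m q pm IH1 mq IH2 px qx]; first exact: coll_inv_exit.
have pm' := join_inv_lt pm; have mq' := join_inv_lt mq.
have ap : arc_a x <= p by case: px => [->|/arc_L_lt] //; lia.
have qb : q <= arc_b x by case: qx => [->|/arc_R_lt] //; lia.
have : arc_a x < m < arc_b x by lia.
case/arc_interior=> h.
- by have [] := IH2 (or_intror h) qx; lia.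
- by have [] := IH1 px (or_intror h); lia.
Qed.

(** In the generated order, a number smaller than [arc_a x] that comes after [arc_b x] also comes
    after [arc_a x], so it does not break the adjacency of the two ends. The next lemma treats
    numbers larger than [arc_b x]. *)
Lemma join_inv_through_a p q : join_inv p q -> p < arc_a x ->
  q = arc_b x \/ arc_R x q -> join_inv p (arc_a x).
Proof.
elim=> {p q} [p q [y Ay pq]|p m q pm IH1 mq IH2] pa qx.
  have aq : arc_a x < q by case: qx => [->|/arc_R_lt]; [case: (x)|lia].
  case: (arc_inv_split pq pa aq) => -[ya h]; first by apply: t_step; exists y.
  have nxy : x <> y by move=> e; subst y; have := arc_R_lt ya; lia.
  case: pq => _ _ qy.
  have [na nb [sep|sep]] := noncrossing_separated Ax Ay nxy.
    by have [_ s2] := sep (arc_a x); case: (s2 (or_introl erefl)).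
  have [s1 s2] := sep q; case: qy => [qy|/s1[]];
    last by case: qx => h'; [constructor 3|constructor].
  by case: qx => [qx|/s2 []//]; [case: nb; rewrite -qx -qy|right].
case: (ltgtP m (arc_a x)) => [ma|am|<-//].
  by apply: t_trans pm _; apply: IH2.
have mq' := join_inv_lt mq.
have qb : q <= arc_b x by case: qx => [->|/arc_R_lt] //; lia.
have : arc_a x < m < arc_b x by lia.
case/arc_interior=> h; last by apply: IH1 => //; right.
by have [] := join_inv_exit mq (or_intror h) qx; lia.
Qed.

Lemma join_inv_through_b p q : join_inv p q -> arc_b x < q ->
  p = arc_a x \/ arc_L x p -> join_inv (arc_b x) q.
Proof.
elim=> {p q} [p q [y Ay pq]|p m q pm IH1 mq IH2] bq px.
  have pb : p < arc_b x by case: px => [->|/arc_L_lt]; [case: (x)|lia].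
  case: (arc_inv_split pq pb bq) => -[yb h]; last by apply: t_step; exists y.
  have nxy : x <> y by move=> e; subst y; have := arc_L_lt yb; lia.
  case: pq => _ py _.
  have [na nb [sep|sep]] := noncrossing_separated Ax Ay nxy; last first.
    by have [s1 _] := sep (arc_b x); case: (s1 yb); constructor 3.
  have [s1 s2] := sep p; case: px => [px|/s1[]];
    last by case: py => h'; [constructor 2|constructor].
  by case: py => [py|/s2 []//]; [case: na; rewrite -px -py|left].
case: (ltgtP m (arc_b x)) => [mb|bm|<-//]; last first.
  by apply: (t_trans _ _ _ m) => //; apply: IH1.
have pm' := join_inv_lt pm.
have ap : arc_a x <= p by case: px => [->|/arc_L_lt] //; lia.
have : arc_a x < m < arc_b x by lia.
case/arc_interior=> h; first by apply: IH2 => //; right.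
by have [] := join_inv_exit pm px (or_intror h); lia.
Qed.

Lemma join_lower_arc n (t : tito n) :
  (forall p q, p < q -> t q p <-> join_inv p q) -> lower_arc t x.
Proof.
move=> tE; have ab : arc_a x < arc_b x by case: (x).
have low l : arc_L x l -> t l (arc_b x).
  move=> Ll; have lab := arc_L_lt Ll; apply: tito_not => [|/tE h]; first lia.
  by have [] := join_inv_exit (h ltac:(lia)) (or_intror Ll) (or_introl erefl); lia.
have upp r : arc_R x r -> t (arc_a x) r.
  move=> Rr; have rab := arc_R_lt Rr; apply: tito_not => [|/tE h]; first lia.
  by have [] := join_inv_exit (h ltac:(lia)) (or_introl erefl) (or_intror Rr); lia.
have tba : t (arc_b x) (arc_a x).
  by apply/tE => //; apply: t_step; exists x => //; apply: arc_inv_ab.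
apply/lower_arcP; split=> //; split=> // c [bc ca].
have nca := tito_neq ca; have nbc := tito_neq bc.
have [ca'|ac|//] := ltgtP c (arc_a x).
  apply: (tito_asym ca); apply/tE => //.
  have cb : join_inv c (arc_b x) by apply/tE => //; lia.
  by apply: (join_inv_through_a cb) => //; left.
have [cb|bc'|e] := ltgtP c (arc_b x); last by case: nbc.
- have : arc_a x < c < arc_b x by lia.
  by move=> /arc_interior[/low/(tito_asym bc)|/upp/(tito_asym ca)].
- apply: (tito_asym bc); apply/tE => //.
  have ac' : join_inv (arc_a x) c by apply/tE.
  by apply: (join_inv_through_b ac') => //; left.
Qed.

End OneArc.

(** By adjacency the pair of ends of [y] is no composite, so it is an inversion of a single arc [x]
    of [A]. The pair of [x] then lies within that of [y], and adjacency forces the two to share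
    [arc_a]. *)
Lemma lower_arc_join n (t : tito n) y :
  (forall p q, p < q -> t q p <-> join_inv p q) -> lower_arc t y -> A y.
Proof.
move=> tE ly; have ab : arc_a y < arc_b y by case: (y).
have /lower_arcP[[ba no] _ _] := ly.
have : join_inv (arc_a y) (arc_b y) by apply/tE.
have split_inv p q : join_inv p q ->
    coll_inv p q \/ exists m, join_inv p m /\ join_inv m q.
  by case=> [r h|m r h1 h2]; [left|right; exists m].
case/split_inv=> [[x Ax [_ ax bx]]|[m [am mb]]]; last first.
  by case: (no m); split; apply/tE => //; apply: join_inv_lt.
have lx := join_lower_arc Ax tE; have /lower_arcP[[xab _] Lx Rx] := lx.
case: ax => [ayx|/Rx axy]; first by rewrite (lower_arc_a_inj ly lx ayx).
have byx : t (arc_b y) (arc_a x).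
  by case: bx => [->//|/Lx h]; apply: tito_trans h xab.
by case: (no (arc_a x)).
Qed.

Lemma join_inv_translate (m : int) p q :
  (forall x, A x -> A (arc_translate m x)) ->
  join_inv p q -> join_inv (p + m) (q + m).
Proof.
move=> Am; elim=> {p q} [p q [x Ax [pq px qx]]|p c q _ h1 _ h2]; last exact: t_trans h1 h2.
apply: t_step; exists (arc_translate m x); first exact: Am.
split; first by rewrite ltrD2r.
- by case: px => [->|h]; [left|right; rewrite /= addrK].
- by case: qx => [->|h]; [left|right; rewrite /= addrK].
Qed.

Lemma join_tito n : (forall x y, A x -> arc_equiv n x y -> A y) ->
  exists t : tito n, forall p q, p < q -> t q p <-> join_inv p q.
Proof.
move=> Ae; apply: biclosed_tito.
- exact: join_inv_lt.
- by move=> a b c; apply: t_trans.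
- by move=> a b c; apply: join_inv_cotrans.
- move=> a b; split.
    apply: join_inv_translate => x Ax; apply: Ae Ax _; apply: rst_step.
    exact: arc_shift_translate.
  rewrite -{2}[a](addrK n%:Z) -{2}[b](addrK n%:Z); apply: join_inv_translate => x Ax.
  apply: Ae Ax _; apply: rst_sym; apply: rst_step; exact: arc_translate_shift.
Qed.

End Join.

(** * Recovering a widely generated order from its lower arcs *)

Section Bijection.
Variable n : nat.
Implicit Types t : tito n.

Lemma lower_arcsE t x : (\bigcup_(W in lower_arcs t) W)%classic x <-> lower_arc t x.
Proof.
split=> [[W lW Wx]|lx]; first exact: lower_arcs_mem lW Wx.
exists [set y | arc_equiv n x y]%classic; last exact: rst_refl.
by split; exists x => //; apply: rst_refl.
Qed.

Lemma bigcup_wrapped_equiv (D : set (set arc)) x y :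
  (D `<=` [set W | wrapped_arc n W])%classic ->
  (\bigcup_(W in D) W)%classic x -> arc_equiv n x y -> (\bigcup_(W in D) W)%classic y.
Proof.
move=> Dw [W DW Wx] xy; exists W => //; move: Wx.
by have [[z ->] _] := Dw W DW => zx; apply: rst_trans zx xy.
Qed.

Lemma wrapped_prearc_eq (W W' : set arc) x : wrapped_prearc n W ->
  wrapped_prearc n W' -> W x -> W' x -> W = W'.
Proof.
move=> [y ->] [z ->] /= yx zx; apply/funext => w; apply/propext => /=.
split=> h; first by apply: rst_trans zx _; apply: rst_trans h; apply: rst_sym.
by apply: rst_trans yx _; apply: rst_trans h; apply: rst_sym.
Qed.

(** Non-inversions of [t] are non-inversions of [s], so the sides of [x] keep their positions in
    [s]; the single wall then brings along all inversions of the arc. *)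
Lemma lower_arc_inv_le s t x p q : wo_le s t -> lower_arc t x ->
  s (arc_b x) (arc_a x) -> arc_inv x p q -> s q p.
Proof.
move=> st /lower_arcP[[tba _] Lx Rx] sba [_ px qx].
have sbp : s (arc_b x) p.
  case: px => [->//|Rp]; apply: tito_trans sba _; have := arc_R_lt Rp => apb.
  apply: tito_not => [|spa]; first lia.
  by apply: (tito_asym (Rx _ Rp)); apply: st spa; lia.
case: qx => [->//|Lq]; apply: tito_trans sbp; have := arc_L_lt Lq => aqb.
apply: tito_not => [|sbq]; first lia.
by apply: (tito_asym (Lx _ Lq)); apply: st sbq; lia.
Qed.

(** An order below [t] containing the walls of all arcs of [A] would contain all generators and
    equal [t]. So any smaller [y] misses a wall, and reversing its translates gives a lower cover
    above [y]. *)
Lemma join_widely_generated (A : set arc) t :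
    (forall x, A x -> lower_arc t x) ->
    (forall p q, p < q -> t q p <-> join_inv A p q) ->
  widely_generated t.
Proof.
move=> lowA tE y /wo_ltP[nyt yt].
have [x Ax nba] : exists2 x, A x & ~ y (arc_b x) (arc_a x).
  apply: contrapT => no; apply: nyt; apply: wo_le_eq => // a b ab /(tE _ _ ab).
  elim=> {a b ab} [p q [x Ax pq]|p m q _ h1 _ h2]; last exact: tito_trans h2 h1.
  apply: (lower_arc_inv_le yt (lowA _ Ax) _ pq).
  by apply: contrapT => nba; apply: no; exists x.
have /lower_arcP[adj _ _] := lowA _ Ax.
have ab : arc_a x < arc_b x by case: (x).
have [|x' cov le] := wall_cover ab adj yt; first by apply: tito_not nba; lia.
by exists x' => //; apply/wo_leP.
Qed.

(** Adjacency leaves every number between a and b either before b or after a, which dictates the two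
    sides. *)
Lemma wall_lower_arc t a b : a < b -> adjacent t b a ->
  exists x, [/\ arc_a x = a, arc_b x = b & lower_arc t x].
Proof.
move=> ab adj; pose L := [set c | a < c < b /\ t c b]%classic.
pose R := [set c | a < c < b /\ t a c]%classic.
have cup : (L `|` R = [set c | a < c < b])%classic.
  apply/funext => c; apply/propext; split=> [[[]|[]]|acb] //.
  have [cb|bc] := tito_or t (a := c) (b := b) ltac:(move: acb => /=; lia).
    by left.
  right; split=> //; apply: tito_not => [|ca]; first by move: acb => /=; lia.
  by case: (adj.2 c).
have cap : (L `&` R = set0)%classic.
  apply/funext => c; apply/propext; split=> // -[[_ cb] [_ ac]].
  by apply: (tito_asym adj.1); apply: tito_trans ac cb.
exists (Arc ab cup cap); split=> //; apply/lower_arcP; split=> // c; by case.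
Qed.

(* The order generated by the lower arcs of t lies below t and has all the walls
   of t as inversions, so it lies below no lower cover of t. *)
Lemma widely_generated_join t : (0 < n)%N -> widely_generated t ->
  forall p q, p < q -> t q p <-> join_inv [set x | lower_arc t x]%classic p q.
Proof.
move=> n0 wg; set A := [set x | _]%classic.
have [s sE] : exists s : tito n, forall p q, p < q -> s q p <-> join_inv A p q.
  by apply: join_tito => x y; rewrite /A /= => lx /(lower_arc_equiv t) <-.
have st : wo_le s t.
  by move=> p q pq /(sE _ _ pq); apply: join_inv_le.
suff -> : t = s by [].
apply: contrapT => nts.
have [|x' cov /wo_leP sx'] := wg s; first by apply/wo_ltP; split=> // /esym.
have [a [b [ab adj x'ab]]] := cover_wall n0 cov.
have [x [xa xb lx]] := wall_lower_arc ab adj.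
apply: (tito_asym x'ab); apply: sx' => //; apply/sE => //.
by apply: t_step; exists x => //; rewrite -xa -xb; apply: arc_inv_ab.
Qed.

End Bijection.

Theorem theorem4p12 (n : nat) (hn : (0 < n)%N) :
  (forall t : tito n, cyclic_noncrossing n (lower_arcs t)) /\
  set_bij [set t : tito n | widely_generated t]%classic
          [set D | cyclic_noncrossing n D]%classic
          (@lower_arcs n).
Proof.
split; first exact: lower_arcs_cyclic_noncrossing.
split=> [t _|t1 t2 /set_mem wg1 /set_mem wg2 e|D [Dw ncD]].
- exact: lower_arcs_cyclic_noncrossing.
(* Injectivity: a widely generated order is the one generated by its lower arcs. *)
- have eA : [set x | lower_arc t1 x]%classic = [set x | lower_arc t2 x]%classic.
    by apply/funext => x; apply/propext; rewrite /= -!lower_arcsE e.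
  have E1 := widely_generated_join hn wg1; have E2 := widely_generated_join hn wg2.
  rewrite eA in E1.
  by apply: wo_le_eq => a b ab h; [apply/E2/E1|apply/E1/E2].
(* Surjectivity: the preimage of [D] is the order generated by all arcs in its classes. *)
- set A := (\bigcup_(W in D) W)%classic in ncD.
  have [t tE] := join_tito (fun x y => bigcup_wrapped_equiv (x := x) (y := y) Dw).
  have lowA x : A x -> lower_arc t x by move=> Ax; apply: (join_lower_arc ncD Ax tE).
  exists t; first exact: join_widely_generated lowA tE.
  apply/funext => W; apply/propext; split=> [[Ww [x Wx lx]]|DW].
    (* A lower arc of [t] lies in some class of [D], and classes sharing an arc coincide. *)
    have [W' DW' W'x] := lower_arc_join ncD tE lx.
    by rewrite (wrapped_prearc_eq Ww (Dw _ DW').1 Wx W'x).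
  have [[x Wx] _] := Dw _ DW; split; first by exists x.
  have xW : W x by rewrite Wx; apply: rst_refl.
  by exists x => //; apply: lowA; exists W.
Qed.
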